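(* For every integer $g \geq 3$, the set $R_g$ of Picard numbers of $g$-dimensional abelian varieties is a proper subset of the set of integers in $[1,g^2]$, i.e. $R_g \subsetneq [1,g^2] \cap \mathbb{N}$.
   Context: Abelian varieties are over the field $\mathbb{C}$ of complex numbers. The Picard number $\rho(A)$ of an abelian variety $A$ is the rank of its Néron–Severi group $\operatorname{NS}(A)$. For $g \geq 1$, $R_g$ denotes the set of all integers $\rho$ such that there exists an abelian variety $A$ of dimension $g$ with $\rho(A) = \rho$. *)

(* Defs.v *)
From HB Require Import structures.
From mathcomp Require Import all_boot all_order all_algebra.
From mathcomp Require Import classical_sets reals.
From mathcomp Require Import complex.

Set Implicit Arguments.
Unset Strict Implicit.
Unset Printing Implicit Defensive.

Import Order.TTheory GRing.Theory Num.Theory.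

Local Open Scope ring_scope.
Local Open Scope complex_scope.
Local Open Scope classical_set_scope.

(* A complex abelian variety of dimension g is a complex torus C^g / L that
   carries a polarization.  Vectors of C^g are row vectors, and a Hermitian
   form on C^g is given by its Gram matrix M in the standard basis:
   H(u, v) = u M v^*, linear in u and conjugate-linear in v. *)

(* A lattice of C^g: the Z-span of a basis of C^g as a real vector space. *)
Definition is_lattice (R : realType) (g : nat) (L : set 'rV[R[i]]_g) : Prop :=
  exists w : 'I_(2 * g) -> 'rV[R[i]]_g,
    (forall a : 'I_(2 * g) -> R,
       \sum_k (a k)%:C *: w k = 0 -> forall k, a k = 0) /\
    L = [set v | exists m : 'I_(2 * g) -> int, v = \sum_k w k *~ m k].

(* The Neron-Severi group of C^g / L: the Hermitian forms whose imaginary part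
   takes integer values on L.  By the Appell-Humbert theorem these are the
   first Chern classes of the holomorphic line bundles on C^g / L, i.e. the
   elements of Pic / Pic^0 = H^2(C^g / L, Z) meet H^{1,1}. *)
Definition neron_severi (R : realType) (g : nat) (L : set 'rV[R[i]]_g) :
    set 'M[R[i]]_g :=
  [set M | M \is hermsymmx /\
     forall u v, L u -> L v -> complex.Im (form Num.conj M u v) \is a Num.int].

(* In R[i], 0 < z means that z is real and positive. *)
Definition positive_definite (R : realType) (g : nat) (M : 'M[R[i]]_g) : Prop :=
  forall u : 'rV[R[i]]_g, u != 0 -> 0 < form Num.conj M u u.

Record abelian_variety (R : realType) (g : nat) := AbelianVariety {
  av_lattice : set 'rV[R[i]]_g;
  av_latticeP : is_lattice av_lattice;
  av_polarizable :
    exists M, neron_severi av_lattice M /\ positive_definite M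
}.

Definition NS (R : realType) (g : nat) (A : abelian_variety R g) :
    set 'M[R[i]]_g :=
  neron_severi (av_lattice A).

Definition Zfree (V : zmodType) (n : nat) (x : 'I_n -> V) : Prop :=
  forall m : 'I_n -> int, \sum_k x k *~ m k = 0 -> forall k, m k = 0.

(* The rank of an abelian group G (here a subgroup of V): the largest size of a
   Z-linearly independent family of elements of G. *)
Definition has_rank (V : zmodType) (G : set V) (r : nat) : Prop :=
  (exists x : 'I_r -> V, (forall k, G (x k)) /\ Zfree x) /\
  (forall n (x : 'I_n -> V), (forall k, G (x k)) -> Zfree x -> (n <= r)%N).

Definition has_picard_number (R : realType) (g : nat)
    (A : abelian_variety R g) (rho : nat) : Prop :=
  has_rank (NS A) rho.

Definition picard_numbers (R : realType) (g : nat) : set nat :=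
  [set rho | exists A : abelian_variety R g, has_picard_number A rho].

(* Main.v *)
Require Import Defs.
From HB Require Import structures.
From mathcomp Require Import all_boot all_order all_algebra.
From mathcomp Require Import classical_sets reals.
From mathcomp Require Import complex.

(** The Neron-Severi group of [C^g / L] is a lattice of hermitian matrices, and a
    polarization [M0] makes its rational span a Jordan algebra: if [X] and [Y]
    are in it, so is [X M0^-1 Y + Y M0^-1 X].  Integral independence in NS is the
    same as complex independence in [M_g(C)], so rank [g^2 - 1] would make the
    complex span of NS a hyperplane [tr (T X) = 0] stable under this product.
    Stability forces [T' Z + Z T'] to be a multiple of [T' = M0 T] whenever
    [tr (T' Z) = 0], and for [g >= 3] rank-one matrices [Z] show that [T' = 0].
    Hence [g^2 - 1] is not a Picard number.  (For [g = 2] the obstruction vanishes: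
    [T' = diag (1, -1)] is possible, and 3 is the Picard number of [E x E]
    when [E] has no complex multiplication.) *)

Set Implicit Arguments.
Unset Strict Implicit.
Unset Printing Implicit Defensive.

Import Order.TTheory GRing.Theory Num.Theory.

Local Open Scope ring_scope.

(** * Linear algebra: rank-one matrices and hyperplanes for the trace pairing *)

Section LinearAlgebra.
Variable F : fieldType.

Lemma mulmx_col_row_eq0 n (u : 'cV[F]_n) (w : 'rV[F]_n) :
  u *m w = 0 -> u = 0 \/ w = 0.
Proof.
move=> uw0; case: (eqVneq w 0) => [|/rV0Pn[j wj]]; [by right | left].
apply/colP=> i; move/matrixP/(_ i j): uw0.
by rewrite !mxE big_ord1 => /eqP; rewrite mulf_eq0 (negPf wj) orbF => /eqP.
Qed.

Lemma rV_orthogonal_neq0 n (u : 'cV[F]_n) :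
  (1 < n)%N -> exists2 v : 'rV_n, v != 0 & v *m u = 0.
Proof.
move=> n_gt1; have: kermx u != 0.
  rewrite kermx_eq0 /row_free neq_ltn (leq_ltn_trans _ n_gt1) //.
  exact: rank_leq_col.
by case/rowV0Pn=> v /sub_kermxP vu v_neq0; exists v.
Qed.

(** The kernel of [w] has dimension at least [n - 1], hence at least two, and so does not fit in the
    line of [u]. *)
Lemma cV_orthogonal_nscaled n (u : 'cV[F]_n) (w : 'rV[F]_n) :
  (2 < n)%N -> exists2 u' : 'cV_n, w *m u' = 0 & forall a, u' <> a *: u.
Proof.
move=> n_gt2; have: ~~ (kermx w^T <= u^T)%MS.
  apply/negP=> /mxrankS; rewrite mxrank_ker leq_subLR leqNgt.
  rewrite (leq_ltn_trans _ n_gt2) // (leq_add (rank_leq_col _)) //.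
  exact: rank_leq_row.
case/row_subPn=> i iP; exists (row i (kermx w^T))^T.
  by apply: trmx_inj; rewrite trmx_mul trmxK -row_mul mulmx_ker row0 trmx0.
move=> a /(congr1 trmx); rewrite trmxK linearZ /= => e.
by move/negP: iP; apply; rewrite e scalemx_sub.
Qed.

(** The hypothesis makes every vector an eigenvector. Basis vectors kill the off-diagonal entries;
    the pair [e_i - e_0], [e_i + e_0] then equates [T i i] with [T 0 0]. *)
Lemma scalar_mx_orthogonal n (T : 'M[F]_n) :
  (0 < n)%N ->
  (forall (v : 'rV_n) (u : 'cV_n), v *m u = 0 -> v *m T *m u = 0) ->
  exists a, T = a%:M.
Proof.
case: n T => // n T _ orthoT.
have Tdelta i k : \tr (delta_mx (0 : 'I_1) i *m T *m delta_mx k 0) = T i k.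
  by rewrite trace_mx11 -rowE -colE !mxE.
have T_offdiag i j : i != j -> T i j = 0.
  move=> neq_ij; rewrite -Tdelta orthoT ?mxtrace0 //.
  exact: mul_delta_mx_0.
exists (T 0 0); apply/matrixP=> i j; rewrite !mxE.
case: (eqVneq i j) => [<-{j}|/T_offdiag->]; rewrite ?mulr0n ?mulr1n //.
have [->//|neq_i0] := eqVneq i 0.
have neq_0i : 0 != i by rewrite eq_sym.
have := orthoT (delta_mx 0 i - delta_mx 0 0) (delta_mx i 0 + delta_mx 0 0).
rewrite !mulmxDr !mulmxBl !mul_delta_mx !mul_delta_mx_0 //.
rewrite subr0 sub0r subrr => /(_ erefl)/(congr1 (@mxtrace _ _)).
rewrite !raddfD /= !raddfN /= !Tdelta mxtrace0.
by rewrite (T_offdiag i 0) // (T_offdiag 0 i) // subr0 sub0r => /subr0_eq.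
Qed.

Lemma trace_hyperplane_anticomm_eq0 n (T : 'M[F]_n) :
  2%:R != 0 :> F -> (2 < n)%N ->
  (forall Z, \tr (T *m Z) = 0 -> exists c, T *m Z + Z *m T = c *: T) ->
  T = 0.
Proof.
move=> char2 n_gt2 anticommT.
(* For [Z = u *m v] the trace condition reads [v T u = 0], and the anticommutator has rank at most
   two. *)
have rk1T (u : 'cV_n) (v : 'rV_n) : v *m T *m u = 0 ->
    exists c, T *m u *m v + u *m (v *m T) = c *: T.
  move=> vTu; have [|c] := anticommT (u *m v); last first.
    by rewrite !mulmxA => e; exists c.
  by rewrite mulmxA mxtrace_mulC mulmxA vTu mxtrace0.
have [->//|T_neq0] := eqVneq T 0.
(* A singular T would have rank one, with its image spanned by every vector of
   its kernel; a regular T cannot be a multiple of a matrix of rank at most two,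
   so it anticommutes with every rank-one Z of its hyperplane and is scalar. *)
have [detT0|detT] := eqVneq (\det T^T) 0.
  have /det0P[u0 u0_neq0 u0T] : \det T^T == 0 by rewrite detT0.
  pose u := u0^T.
  have u_neq0 : u != 0 by rewrite trmx_eq0.
  have Tu : T *m u = 0 by rewrite -[T]trmxK -trmx_mul u0T trmx0.
  have [i [j Tij]] : exists i j, T i j != 0.
    by apply/matrix0Pn.
  pose v : 'rV[F]_n := delta_mx 0 i.
  have vT_neq0 : v *m T != 0.
    by rewrite -rowE; apply/rV0Pn; exists j; rewrite mxE.
  have [|c] := rk1T u v; first by rewrite -mulmxA Tu mulmx0.
  rewrite Tu mul0mx add0r => uvT.
  have c_neq0 : c != 0.
    apply: contra_neq vT_neq0 => c0; move: uvT; rewrite c0 scale0r.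
    by case/mulmx_col_row_eq0 => // u0'; rewrite u0' eqxx in u_neq0.
  (* Since [c T = u (v T)], any [u'] killed by [v T] is killed by [T]; the same argument then gives
     [u' (v T) = c' T], which forces [u'] into the line of [u]. *)
  have [u' vTu' u'P] := cV_orthogonal_nscaled u (v *m T) n_gt2.
  have Tu' : T *m u' = 0.
    apply: (scalerI c_neq0); rewrite scaler0 scalemxAl -uvT -mulmxA vTu'.
    exact: mulmx0.
  have [c'] := rk1T u' v vTu'; rewrite Tu' mul0mx add0r => u'vT.
  have : (c *: u' - c' *: u) *m (v *m T) = 0.
    by rewrite mulmxBl -!scalemxAl uvT u'vT !scalerA mulrC subrr.
  case/mulmx_col_row_eq0 => [/subr0_eq e|e]; last by rewrite e eqxx in vT_neq0.
  case: (u'P (c^-1 * c')).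
  by rewrite -scalerA -e scalerA mulVf // scale1r.
have rkT : \rank T = n.
  by apply/eqP; rewrite -[_ == n]/(row_free T) row_free_unit unitmxE -det_tr unitfE.
have rk1T0 (u : 'cV_n) (v : 'rV_n) : v *m T *m u = 0 ->
    T *m u *m v + u *m (v *m T) = 0.
  move=> /rk1T[c eq_cT]; have [c0|c_neq0] := eqVneq c 0.
    by rewrite eq_cT c0 scale0r.
  have: (\rank (c *: T) <= 1 + 1)%N.
    rewrite -eq_cT (leq_trans (mxrank_add _ _)) // leq_add //.
      by rewrite (leq_trans (mxrankM_maxr _ _)) // rank_leq_row.
    by rewrite (leq_trans (mxrankM_maxl _ _)) // rank_leq_col.
  by rewrite (eqmx_scale T c_neq0) rkT leqNgt n_gt2.
have n_gt0 : (0 < n)%N by rewrite (leq_trans _ n_gt2).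
have [|a Ta] := @scalar_mx_orthogonal _ T n_gt0.
  move=> v' u v'u.
  (* Multiplying the rank-one identity on the left by [v'] leaves [(v' T u) v = 0] with [v]
     nonzero. *)
  have [v v_neq0 vTu] := rV_orthogonal_neq0 (T *m u) (ltnW n_gt2).
  have /rk1T0 /(congr1 (mulmx v')) : v *m T *m u = 0 by rewrite -mulmxA.
  rewrite mulmx0 mulmxDr !mulmxA v'u !mul0mx addr0 => v'Tuv.
  move: v'Tuv; rewrite [v' *m T *m u]mx11_scalar mul_scalar_mx => /eqP.
  by rewrite scaler_eq0 (negPf v_neq0) orbF => /eqP->; rewrite raddf0.
have n_gt1 := ltnW n_gt2.
pose i0 := Ordinal n_gt0; pose i1 := Ordinal n_gt1.
(* For [T] scalar, an off-diagonal unit [Z] has [tr (T Z) = 0], and its nonzero entry gives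
   [2 a = 0]. *)
have [|c] := anticommT (delta_mx i0 i1).
  rewrite Ta mul_scalar_mx linearZ /= -(mul_delta_mx (0 : 'I_1)) mxtrace_mulC.
  by rewrite mul_delta_mx_0 // mxtrace0 mulr0.
rewrite Ta mul_scalar_mx mul_mx_scalar => /matrixP/(_ i0 i1).
rewrite !mxE !eqxx mulr1 mulr0n mulr0 -mulr2n -mulr_natl => /eqP.
by rewrite mulf_eq0 (negPf char2) => /eqP->; rewrite raddf0.
Qed.

Lemma trace_form_proportional n (S T : 'M[F]_n) :
  T != 0 -> (forall Y, \tr (T *m Y) = 0 -> \tr (S *m Y) = 0) ->
  exists c, S = c *: T.
Proof.
case/matrix0Pn=> i [j Tij] kerS.
have tr_delta (A : 'M[F]_n) k l : \tr (A *m delta_mx l k) = A k l.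
  rewrite -(mul_delta_mx (0 : 'I_1)) mulmxA mxtrace_mulC mulmxA.
  by rewrite trace_mx11 -rowE -colE !mxE.
exists (S i j / T i j); apply/matrixP=> k l; rewrite mxE.
(* This combination is chosen so that its trace against [T] cancels; its trace against [S] is a
   two-by-two minor of the pair. *)
have := kerS (T i j *: delta_mx l k - T k l *: delta_mx j i).
rewrite !mulmxBr -!scalemxAr !raddfB /= !mxtraceZ !tr_delta.
rewrite [X in X - _]mulrC subrr => /(_ erefl)/subr0_eq e.
by apply: (mulfI Tij); rewrite e mulrA mulrCA mulfV // mulr1 mulrC.
Qed.

(** The cokernel of [X] has rank one, so it factors as a column times a row; the column is a single
    linear equation, which unflattened and transposed becomes [T]. *)
Lemma trace_hyperplane n N (X : 'M[F]_(N, n * n)) :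
  (\rank X).+1 = (n * n)%N ->
  exists2 T : 'M[F]_n, T != 0 &
    forall Y, (mxvec Y <= X)%MS = (\tr (T *m Y) == 0).
Proof.
move=> rkX; pose K := cokermx X.
have rkK : \rank K = 1%N.
  apply/eqP; rewrite mxrank_coker -(eqn_add2r (\rank X)) subnK ?rank_leq_col //.
  by rewrite add1n rkX.
have [t [r [t_neq0 r_free Ktr]]] : exists (t : 'cV[F]_(n * n)) (r : 'rV_(n * n)),
    [/\ t != 0, row_free r & K = t *m r].
  move: (col_base K) (row_base K) (mulmx_base K) (row_base_free K).
  rewrite rkK => t r Ktr r_free; exists t, r; split=> //.
  by apply: contra_eq_neq rkK => t0; rewrite -Ktr t0 mul0mx mxrank0.
exists (vec_mx t^T)^T.
  apply: contra_neq t_neq0 => /(congr1 trmx); rewrite trmx0 trmxK.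
  move/(congr1 mxvec); rewrite vec_mxK linear0.
  by move/(congr1 trmx); rewrite trmxK trmx0.
move=> Y; rewrite submxE -/K Ktr mulmxA -[X in _ == X](mul0mx _ r).
rewrite (inj_eq (row_free_inj r_free)).
suff trE : (mxvec Y *m t) 0 0 = \tr ((vec_mx t^T)^T *m Y).
  apply/eqP/eqP => [Yt0|trY0]; first by rewrite -trE Yt0 mxE.
  by rewrite [LHS]mx11_scalar trE trY0 raddf0.
rewrite -[t in LHS]trmxK -[t^T in LHS]vec_mxK mxE.
rewrite (reindex _ (curry_mxvec_bij _ _)) /=.
rewrite /mxtrace; under [RHS]eq_bigr do rewrite mxE.
rewrite exchange_big pair_bigA; apply: eq_bigr => [[i j]] /= _.
by rewrite [in X in _ * X]mxE !mxvecE [in RHS]mxE mulrC.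
Qed.

End LinearAlgebra.

(** Row freeness over [F] descends to the rationals, where clearing denominators turns any relation
    into an integral one. *)
Lemma row_free_intr (F : numFieldType) n N (A : 'M[int]_(n, N)) :
  (forall m : 'rV_n, m *m A = 0 -> m = 0) ->
  row_free (map_mx intr A : 'M[F]_(n, N)).
Proof.
move=> freeA.
have -> : map_mx intr A = map_mx ratr (map_mx intr A : 'M[rat]_(n, N))
    :> 'M[F]_(n, N).
  by apply/matrixP=> i j; rewrite !mxE ratr_int.
rewrite row_free_map; apply: inj_row_free => v vA0.
pose d := \prod_j denq (v 0 j).
have d_neq0 : d%:~R != 0 :> rat.
  by rewrite intr_eq0; apply/prodf_neq0 => j _; apply: denq_neq0.
have [m dv] : exists m : 'rV[int]_n, map_mx intr m = d%:~R *: v.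
  exists (\row_j (numq (v 0 j) * \prod_(k | k != j) denq (v 0 k))).
  apply/rowP=> j; rewrite !mxE /d [in RHS](bigD1 j) //= !intrM.
  by rewrite mulrAC [_ * v 0 j]mulrC -numqE.
have : m *m A = 0.
  have: map_mx intr (m *m A) = 0 :> 'M[rat]_(1, N).
    by rewrite map_mxM dv -scalemxAl vA0 scaler0.
  move=> /matrixP mA0; apply/matrixP=> i j; apply: (@intr_inj rat).
  by have := mA0 i j; rewrite !mxE.
by move/freeA=> m0; apply: (scalerI d_neq0); rewrite -dv m0 map_mx0 scaler0.
Qed.

(** * Triple products of hermitian matrices seen through integral Gram matrices *)

Section HermitianExtension.
Variable C : numClosedFieldType.

(* For the period matrices below and M hermitian this is the Gram matrix of Im M
   on the lattice; writing M^T for the conjugate of M makes it C-linear in M,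
   also outside the hermitian matrices. *)
Definition period_form g m (S : 'M[C]_(m, g + g)) (Q : 'M[C]_(g + g, m))
    (M : 'M[C]_g) : 'M[C]_m :=
  S *m block_mx M 0 0 (- M^T) *m Q.

Lemma period_form_is_linear g m (S : 'M[C]_(m, g + g)) Q :
  linear (period_form S Q).
Proof.
move=> a A B; rewrite /period_form linearD linearZ /=.
rewrite scalemxAl scalemxAr -mulmxDl -mulmxDr; congr (_ *m _ *m _).
by rewrite scale_block_mx add_block_mx !scaler0 !addr0 scalerN opprD.
Qed.

HB.instance Definition _ g m S Q :=
  GRing.isLinear.Build C 'M[C]_g 'M[C]_m _ (@period_form g m S Q)
    (period_form_is_linear S Q).

Lemma period_form_inj g (S Q : 'M[C]_(g + g)) :
  S \in unitmx -> Q \in unitmx -> injective (period_form S Q).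
Proof.
move=> uS uQ A B /(can_inj (mulmxK uQ))/(can_inj (mulKmx uS)).
by case/eq_block_mx.
Qed.

(** Transposition reverses the factors and three signs leave one, so after symmetrization in [X] and
    [Y] the product is again of the shape [diag (Z, - Z^T)]. *)
Lemma block_triple g (X P Y : 'M[C]_g) :
  block_mx X 0 0 (- X^T) *m block_mx P 0 0 (- P^T) *m block_mx Y 0 0 (- Y^T) =
  block_mx (X *m P *m Y) 0 0 (- (Y *m P *m X)^T).
Proof.
rewrite !mulmx_block !(mulmx0, mul0mx, addr0, add0r); congr block_mx.
by rewrite !trmx_mul !(mulmxN, mulNmx) opprK mulmxA.
Qed.


(** In [E1 E^-1 E2] the inner copies of [S] and [Q] cancel. The factor [\det E] replaces [E^-1] by
    the adjugate, which keeps the result integral. *)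
Lemma period_form_triple g (S Q : 'M[C]_(g + g)) (M X Y : 'M[C]_g)
    (E E1 E2 : 'M[int]_(g + g)) :
  S \in unitmx -> Q \in unitmx -> M \in unitmx ->
  period_form S Q M = map_mx intr E ->
  period_form S Q X = map_mx intr E1 ->
  period_form S Q Y = map_mx intr E2 ->
  (\det E)%:~R != 0 :> C /\
  period_form S Q
    ((\det E)%:~R *: (X *m invmx M *m Y + Y *m invmx M *m X)) =
  map_mx intr (E1 *m \adj E *m E2 + E2 *m \adj E *m E1).
Proof.
move=> uS uQ uM defE defE1 defE2; set P := invmx M.
have block_inv : block_mx M 0 0 (- M^T) *m block_mx P 0 0 (- P^T) = 1%:M.
  rewrite mulmx_block !(mulmx0, mul0mx, addr0, add0r) mulmxV //.
  by rewrite mulmxN mulNmx opprK -trmx_mul mulVmx // trmx1 -scalar_mx_block.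
have uE : (map_mx intr E : 'M[C]_(g + g)) \in unitmx.
  rewrite -defE /period_form !unitmx_mul uS uQ !andbT /=.
  by case/mulmx1_unit: block_inv.
have invE : invmx (map_mx intr E) = invmx Q *m block_mx P 0 0 (- P^T) *m invmx S.
  apply: (can_inj (mulKmx uE)); rewrite mulmxV // -defE /period_form.
  rewrite -!mulmxA (mulKVmx uQ) [_ *m (_ *m invmx S)]mulmxA block_inv mul1mx.
  by rewrite mulmxV.
have detE : (\det E)%:~R != 0 :> C.
  by move: uE; rewrite unitmxE unitfE det_map_mx.
split=> //.
have tripleE (A B : 'M[C]_g) : period_form S Q A *m invmx (map_mx intr E) *m
    period_form S Q B =
    S *m block_mx (A *m P *m B) 0 0 (- (B *m P *m A)^T) *m Q.
  rewrite invE -block_triple /period_form !mulmxA.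
  by rewrite (mulmxK uQ) (mulmxKV uS).
rewrite linearZ /= [RHS]map_mxD !map_mxM map_mx_adj.
have -> : \adj (map_mx intr E) = (\det E)%:~R *: invmx (map_mx intr E)
    :> 'M[C]_(g + g).
  by rewrite /invmx uE scalerA det_map_mx mulfV // scale1r.
rewrite -!scalemxAr -!scalemxAl -scalerDr -defE1 -defE2 !tripleE.
rewrite -mulmxDl -mulmxDr add_block_mx !addr0 -opprD -linearD /=.
by rewrite [Y *m P *m X + _]addrC.
Qed.

End HermitianExtension.

Local Open Scope complex_scope.

(** * Period matrices, and integrality on the lattice as integrality of a matrix *)

Section Periods.
Variables (R : realType) (g : nat).
Implicit Types (M : 'M[R[i]]_g) (L : set 'rV[R[i]]_g).
Local Notation C := R[i].

Lemma hermsymmxP M : reflect (map_mx Num.conj M = M^T) (M \is hermsymmx).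
Proof.
apply: (iffP (is_hermitianmxP _ _ _)); rewrite expr0 scale1r.
  by move=> {2}->; rewrite map_trmx trmxK.
by move=> e; rewrite -map_trmx e trmxK.
Qed.

Lemma conj_mxK m n (A : 'M[C]_(m, n)) : map_mx Num.conj (map_mx Num.conj A) = A.
Proof. by apply/matrixP=> i j; rewrite !mxE conjCK. Qed.

Definition mx_of_periods m (w : 'I_m -> 'rV[C]_g) : 'M[C]_(m, g + g) :=
  row_mx (\matrix_k w k) (map_mx Num.conj (\matrix_k w k)).

(** The factor [1 / (2 i)] is the one in [Im z = (z - conj z) / (2 i)]. *)
Definition dual_mx_of_periods m (w : 'I_m -> 'rV[C]_g) : 'M[C]_(g + g, m) :=
  (2%:R * 'i)^-1 *: (map_mx Num.conj (mx_of_periods w))^T.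

(** A complex relation among the rows holds for its conjugate too, so its real and imaginary parts
    are real relations among the periods. *)
Lemma mx_of_periods_unit (w : 'I_(g + g) -> 'rV[R[i]]_g) :
  (forall a : 'I_(g + g) -> R,
     \sum_k (a k)%:C *: w k = 0 -> forall k, a k = 0) ->
  mx_of_periods w \in unitmx.
Proof.
move=> free_w; rewrite -row_free_unit; apply: inj_row_free => v.
rewrite mul_mx_row -row_mx0 => /eq_row_mx[vB0 vcB0].
set B := \matrix_k w k in vB0 vcB0.
have cvB0 : map_mx Num.conj v *m B = 0.
  have /(congr1 (map_mx Num.conj)) := vcB0.
  by rewrite map_mxM map_mx0 conj_mxK.
have comb0 (a : 'rV[C]_(g + g)) (r : 'I_(g + g) -> R) :
    (forall k, (r k)%:C = a 0 k) -> a *m B = 0 -> forall k, r k = 0.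
  move=> ra aB0; apply: free_w; rewrite -[RHS]aB0 mulmx_sum_row.
  by apply: eq_bigr => k _; rewrite rowK ra.
have Re0 : forall k, complex.Re (v 0 k) = 0.
  apply: (comb0 (2%:R^-1 *: (v + map_mx Num.conj v))) => [k|].
    by rewrite !mxE ReJ_add mulrC.
  by rewrite -scalemxAl mulmxDl vB0 cvB0 addr0 scaler0.
have Im0 : forall k, complex.Im (v 0 k) = 0.
  apply: (comb0 (('i / 2%:R) *: (map_mx Num.conj v - v))) => [k|].
    by rewrite !mxE ImJ_sub -mulrA mulrC [_^-1 * _]mulrC.
  by rewrite -scalemxAl mulmxBl vB0 cvB0 subrr scaler0.
rewrite row_mx0; apply/rowP=> k; rewrite [RHS]mxE [LHS]complexE Re0 Im0.
by rewrite !rmorph0 mulr0 addr0.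
Qed.

Lemma dual_mx_of_periods_unit (w : 'I_(g + g) -> 'rV[R[i]]_g) :
  mx_of_periods w \in unitmx -> dual_mx_of_periods w \in unitmx.
Proof.
move=> uS; rewrite /dual_mx_of_periods unitmxZ ?unitmx_tr ?map_unitmx //.
by rewrite unitrV unitfE mulf_neq0 ?neq0Ci ?pnatr_eq0.
Qed.

Lemma Im_form_periods m (w : 'I_m -> 'rV[R[i]]_g) M (a b : 'rV[C]_m) :
  M \is hermsymmx -> map_mx Num.conj a = a -> map_mx Num.conj b = b ->
  (complex.Im (form Num.conj M (a *m \matrix_k w k) (b *m \matrix_k w k)))%:C =
  (a *m period_form (mx_of_periods w) (dual_mx_of_periods w) M *m b^T) 0 0.
Proof.
move=> /hermsymmxP hM ra rb; set B := \matrix_k w k.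
have rbT : map_mx Num.conj b^T = b^T by rewrite -map_trmx rb.
set z := form _ _ _ _.
have zE : z = (a *m B *m M *m map_mx Num.conj B^T *m b^T) 0 0.
  by rewrite /z /form trmx_mul map_mxM rbT !mulmxA.
have zcE : Num.conj z = (a *m map_mx Num.conj B *m M^T *m B^T *m b^T) 0 0.
  transitivity (map_mx Num.conj (a *m B *m M *m map_mx Num.conj B^T *m b^T) 0 0).
    by rewrite zE [RHS]mxE; reflexivity.
  by rewrite !map_mxM ra hM rbT -!map_trmx conj_mxK.
have -> : (complex.Im z)%:C = (2%:R * 'i)^-1 * (z - Num.conj z).
  by rewrite [z - _]subcJ mulrAC mulKf // mulf_neq0 ?neq0Ci ?pnatr_eq0.
rewrite zcE zE /period_form /dual_mx_of_periods /mx_of_periods -/B.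
rewrite map_row_mx tr_row_mx -scalemxAr -scalemxAr -scalemxAl [RHS]mxE.
congr (_ * _).
rewrite mul_row_block !mulmx0 addr0 add0r mul_row_col conj_mxK.
rewrite mulmxDr mulmxDl mulmxN mulNmx mulmxN mulNmx !mulmxA [RHS]mxE.
by rewrite [X in _ = _ + X]mxE map_trmx.
Qed.

(** By biadditivity, integrality on the lattice can be tested on pairs of basis periods, whose
    values are the entries of the Gram matrix. *)
Lemma neron_severi_period_form L :
  is_lattice L ->
  exists S Q : 'M[C]_(g + g),
  [/\ S \in unitmx, Q \in unitmx &
      forall M, M \is hermsymmx ->
        (neron_severi L M <->
         exists E : 'M[int]_(g + g), period_form S Q M = map_mx intr E)].
Proof.
rewrite /is_lattice mul2n -addnn => -[w [free_w ->{L}]].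
have uS := mx_of_periods_unit free_w.
exists (mx_of_periods w), (dual_mx_of_periods w); split=> //.
  exact: dual_mx_of_periods_unit.
move=> M hM; set B := \matrix_k w k.
have conj_int m n (E : 'M[int]_(m, n)) :
    map_mx Num.conj (map_mx intr E : 'M[C]_(m, n)) = map_mx intr E.
  by apply/matrixP=> i j; rewrite !mxE rmorph_int.
have combE (m : 'I_(g + g) -> int) :
    \sum_k w k *~ m k = map_mx intr (\row_k m k) *m B.
  by rewrite mulmx_sum_row; apply: eq_bigr => k _; rewrite rowK !mxE scaler_int.
split=> [[_ intM]|[E defE]]; last first.
  split=> // _ _ [m ->] [n ->]; rewrite !combE.
  set a := \row_k m k; set b := \row_k n k.
  have := Im_form_periods w hM (conj_int _ _ a) (conj_int _ _ b).
  rewrite -/B defE map_trmx -!map_mxM [in RHS]mxE => e.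
  apply/intrP; exists ((a *m E *m b^T) 0 0); apply: (@complexI R).
  by rewrite e rmorph_int.
have int_entry i j : exists e : int,
    period_form (mx_of_periods w) (dual_mx_of_periods w) M i j == e%:~R.
  have in_lattice k : (exists m : 'I_(g + g) -> int, w k = \sum_l w l *~ m l).
    exists (fun l => (l == k)%:R); rewrite (bigD1 k) //= eqxx mulr1z.
    by rewrite big1 ?addr0 // => l /negPf->; rewrite mulr0z.
  have /intrP[e defe] := intM _ _ (in_lattice i) (in_lattice j).
  exists e; rewrite -(rmorph_int (real_complex R)) /= -defe.
  have conj_delta k :
      map_mx Num.conj (delta_mx 0 k) = delta_mx 0 k :> 'rV[C]_(g + g).
    by rewrite map_delta_mx.
  have := Im_form_periods w hM (conj_delta i) (conj_delta j).
  rewrite -!rowE !rowK => ->.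
  by rewrite trmx_delta -colE !mxE eqxx.
pose E := \matrix_(i, j) xchoose (int_entry i j).
by exists E; apply/matrixP=> i j; rewrite [RHS]mxE [E i j]mxE;
  apply/eqP/(xchooseP (int_entry i j)).
Qed.

End Periods.

(** * The complex span of the Neron-Severi group *)

Section NeronSeveri.
Variables (R : realType) (g : nat).
Local Notation C := R[i].
Implicit Types (M X Y : 'M[C]_g) (L : set 'rV[C]_g).

(** [period_form] is linear and injective and sends these classes to integral matrices, for which
    integral and complex independence agree. *)
Lemma neron_severi_row_free L n (x : 'I_n -> 'M[C]_g) :
  is_lattice L -> (forall k, neron_severi L (x k)) -> Zfree x ->
  row_free (\matrix_k mxvec (x k)).
Proof.
case/neron_severi_period_form=> S [Q [uS uQ intP]] NSx freex.
have E0 k : exists E : 'M[int]_(g + g), period_form S Q (x k) == map_mx intr E.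
  have [hxk _] := NSx k; have /(intP _ hxk)[E defE] := NSx k.
  by exists E; rewrite defE.
pose A := \matrix_k mxvec (xchoose (E0 k)).
set X := \matrix_k _.
have defA : X *m lin_mx (period_form S Q) = map_mx intr A.
  apply/row_matrixP=> k; rewrite row_mul -map_row !rowK mul_vec_lin map_mxvec.
  by congr mxvec; apply/eqP/(xchooseP (E0 k)).
have freeA : row_free (map_mx intr A : 'M[C]_(n, (g + g) * (g + g))).
  apply: row_free_intr => m mA0; apply/rowP=> k; rewrite [RHS]mxE.
  apply: freex.
  have YE : map_mx intr m *m X = mxvec (\sum_k x k *~ m 0 k).
    rewrite mulmx_sum_row linear_sum; apply: eq_bigr => l _.
    by rewrite rowK mxE scaler_int raddfMz.
  apply: (period_form_inj uS uQ); rewrite [RHS]linear0.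
  apply: (can_inj mxvecK); rewrite -mul_vec_lin -YE -mulmxA defA -map_mxM mA0.
  by rewrite map_mx0 linear0.
apply: inj_row_free => v vX0; apply: (row_free_inj freeA).
by rewrite -defA mulmxA vX0 !mul0mx.
Qed.

(** Otherwise prepending [Y] to [x] would give [n + 1] independent classes. *)
Lemma has_rank_submx L n (x : 'I_n -> 'M[C]_g) Y :
  (forall m (y : 'I_m -> 'M[C]_g),
     (forall k, neron_severi L (y k)) -> Zfree y -> (m <= n)%N) ->
  (forall k, neron_severi L (x k)) -> Zfree x -> neron_severi L Y ->
  (mxvec Y <= \matrix_k mxvec (x k))%MS.
Proof.
move=> maxn NSx freex NSY; set X := \matrix_k _; apply: contraT => YX.
pose y k := if unlift 0 k is Some l then x l else Y.
have := maxn n.+1 y; rewrite ltnn; apply.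
  by move=> k; rewrite /y; case: unlift.
move=> m; rewrite big_ord_recl {1}/y unlift_none => sum0.
have sumE : \sum_i y (lift ord0 i) *~ m (lift ord0 i) =
            \sum_i x i *~ m (lift ord0 i).
  by apply: eq_bigr => i _; rewrite /y liftK.
rewrite sumE in sum0.
have m0 : m ord0 = 0.
  apply: contraNeq YX => m0_neq0.
  have m0C : (m ord0)%:~R != 0 :> C by rewrite intr_eq0.
  rewrite -(eqmx_scale _ m0C) -linearZ /= scaler_int.
  move/addr0_eq: sum0 => sum0; rewrite -[X in mxvec X]opprK sum0 linearN /=.
  rewrite linear_sum /= eqmx_opp; apply: summx_sub => k _.
  rewrite -scaler_int linearZ scalemx_sub //.
  by have := row_sub k X; rewrite rowK.
move: sum0; rewrite m0 mulr0z add0r => /freex m_lift0 k.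
by case: (unliftP ord0 k) => [l ->|->].
Qed.

Lemma neron_severi_triple L M X Y :
  is_lattice L -> neron_severi L M -> M \in unitmx ->
  neron_severi L X -> neron_severi L Y ->
  exists2 N : C, N != 0 &
    neron_severi L (N *: (X *m invmx M *m Y + Y *m invmx M *m X)).
Proof.
case/neron_severi_period_form=> S [Q [uS uQ intP]] NSM uM NSX NSY.
have [[hM _] [[hX _] [hY _]]] := (NSM, (NSX, NSY)).
have /(intP _ hM)[E defE] := NSM.
have /(intP _ hX)[E1 defE1] := NSX; have /(intP _ hY)[E2 defE2] := NSY.
have [detE eqE] := period_form_triple uS uQ uM defE defE1 defE2.
exists (\det E)%:~R; first exact: detE.
apply/(intP _ _); last by eexists; apply: eqE.
apply/hermsymmxP.
move/hermsymmxP: hX => hX; move/hermsymmxP: hY => hY; move/hermsymmxP: hM => hM.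
set P := invmx M; have hP : map_mx Num.conj P = P^T by rewrite map_invmx hM trmx_inv.
rewrite map_mxZ map_mxD !map_mxM hX hY hP rmorph_int linearZ /=.
by congr (_ *: _); rewrite linearD /= !trmx_mul !mulmxA addrC.
Qed.

Lemma positive_definite_unitmx M : positive_definite M -> M \in unitmx.
Proof.
move=> posM; rewrite -row_free_unit; apply: inj_row_free => u uM0.
apply: contraTeq isT => /posM; rewrite /form uM0 mul0mx mxE.
by rewrite ltxx.
Qed.

Lemma mxtrace_submx_eq0 n (x : 'I_n -> 'M[C]_g) (S Z : 'M[C]_g) :
  (forall k, \tr (S *m x k) = 0) -> (mxvec Z <= \matrix_k mxvec (x k))%MS ->
  \tr (S *m Z) = 0.
Proof.
move=> Sx0 /submxP[a defZ].
have -> : Z = \sum_k a 0 k *: x k.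
  apply: (can_inj mxvecK); rewrite defZ mulmx_sum_row linear_sum.
  by apply: eq_bigr => k _; rewrite rowK linearZ.
rewrite mulmx_sumr raddf_sum big1 // => k _.
by rewrite /= -scalemxAr mxtraceZ Sx0 mulr0.
Qed.

(** Isolating [X] exhibits the condition as a trace form in [X], so that it extends from a family to
    its complex span. *)
Lemma mxtrace_triple (T P X Y : 'M[C]_g) :
  \tr (T *m (X *m P *m Y + Y *m P *m X)) =
  \tr ((P *m Y *m T + T *m Y *m P) *m X).
Proof.
rewrite mulmxDr mulmxDl !mxtraceD !mulmxA; congr (_ + _).
by rewrite -[T *m X *m P *m Y]mulmxA [LHS]mxtrace_mulC !mulmxA.
Qed.

Lemma rank_neron_severi_neq L :
  (2 < g)%N -> is_lattice L ->
  (exists M, neron_severi L M /\ positive_definite M) ->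
  ~ has_rank (neron_severi L) (g ^ 2).-1.
Proof.
move=> g_gt2 latL [M0 [NSM0 /positive_definite_unitmx uM0]].
set n := _.-1 => -[[x [NSx freex]] maxn].
have rkX : (\rank (\matrix_k mxvec (x k))).+1 = (g * g)%N.
  have /eqP-> := neron_severi_row_free latL NSx freex.
  by rewrite prednK ?mulnn // expn_gt0 (leq_trans _ g_gt2).
have [T T_neq0 WE] := trace_hyperplane rkX.
have NS_T Y : neron_severi L Y -> \tr (T *m Y) = 0.
  by move=> NSY; apply/eqP; rewrite -WE; apply: has_rank_submx maxn NSx freex NSY.
set P := invmx M0.
have NS2 X Y : neron_severi L X -> neron_severi L Y ->
    \tr (T *m (X *m P *m Y + Y *m P *m X)) = 0.
  move=> NSX NSY; have [N N_neq0] := neron_severi_triple latL NSM0 uM0 NSX NSY.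
  move/NS_T; rewrite -scalemxAr mxtraceZ => /eqP.
  by rewrite mulf_eq0 (negPf N_neq0) => /eqP.
(* [NS2] extends to the whole hyperplane by linearity, one variable at a time. *)
have W2 X Y : \tr (T *m X) = 0 -> \tr (T *m Y) = 0 ->
    \tr ((P *m X *m T + T *m X *m P) *m Y) = 0.
  move=> /eqP; rewrite -WE => WX /eqP; rewrite -WE => WY.
  apply: mxtrace_submx_eq0 WY => k; rewrite -mxtrace_triple addrC mxtrace_triple.
  apply: mxtrace_submx_eq0 WX => l; rewrite -mxtrace_triple.
  exact: NS2.
have anticommT Z : \tr (M0 *m T *m Z) = 0 ->
    exists c, M0 *m T *m Z + Z *m (M0 *m T) = c *: (M0 *m T).
  rewrite -mulmxA mxtrace_mulC -mulmxA => TZ0.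
  (* With [X = Z M0] the matrix in [W2] is [P Z M0 T + T Z]; multiplying it by [M0] on the left
     gives the anticommutator of [Z] and [M0 T]. *)
  have [c] := trace_form_proportional T_neq0 (fun Y => W2 (Z *m M0) Y TZ0).
  move/(congr1 (mulmx M0)); rewrite mulmxDr -scalemxAr => defc; exists c.
  rewrite -defc addrC; congr (_ + _).
    by rewrite !mulmxA mulmxV // mul1mx.
  by rewrite !mulmxA mulmxK.
case/eqP: T_neq0; rewrite -[T](mulKmx uM0).
rewrite (trace_hyperplane_anticomm_eq0 _ g_gt2 anticommT) ?mulmx0 //.
by rewrite pnatr_eq0.
Qed.

End NeronSeveri.

Local Open Scope classical_set_scope.

Theorem mainTheorem3 (R : realType) (g : nat) (hg : (3 <= g)%N) :
  picard_numbers R g `<` [set rho : nat | (1 <= rho <= g ^ 2)%N].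
Proof.
split=> [rho [[L latL [M [NSM posM]]] /= [[x [NSx freex]] maxrho]]|].
  apply/andP; split.
    (* The polarization is invertible, hence nonzero, and generates an infinite cyclic group. *)
    apply: (maxrho 1 (fun=> M)) => // m; rewrite big_ord1 -scaler_int => /eqP.
    rewrite scaler_eq0 intr_eq0 => /orP[/eqP m0 k|/eqP M0]; first by rewrite ord1.
    have := positive_definite_unitmx posM.
    by rewrite -row_free_unit /row_free M0 mxrank0; case: (g) hg.
  have /eqP <- := neron_severi_row_free latL NSx freex.
  by rewrite -mulnn rank_leq_col.
have g2_gt1 : (1 < g ^ 2)%N by rewrite -(exp1n 2) ltn_exp2r // (leq_trans _ hg).
(* The missing value is [g ^ 2 - 1], which is at least one since [1 < g ^ 2]. *)
move=> /(_ (g ^ 2).-1); case.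
  by rewrite /= leq_pred andbT -ltnS prednK // ltnW.
by move=> [L latL polL] /(rank_neron_severi_neq hg latL polL).
Qed.
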